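(* Let $n\geqslant 1$, let $\mathcal{H}_1,\ldots,\mathcal{H}_n,\mathcal{H}$ be complex Hilbert spaces, and for $k=1,\ldots,n$ let $A_k:\mathcal{H}_k\to\mathcal{H}$ be a bounded linear operator with closed range $Ran(A_k)$. Suppose that positive reals $\gamma_1,\ldots,\gamma_n$ and reals $\varepsilon_{i,j}$ ($i\neq j$) with $\varepsilon_{i,j}=\varepsilon_{j,i}$ satisfy (1) $\gamma_e(A_k)\geqslant\gamma_k>0$ for $k=1,\ldots,n$; (2) $\|A_i^*A_j\|_e\leqslant\varepsilon_{i,j}$ for all $i\neq j$. Define the real symmetric $n\times n$ matrix $M=(m_{i,j})$ by $m_{i,i}=\gamma_i^2$ and $m_{i,j}=-\varepsilon_{i,j}$ for $i\neq j$. If $M$ is positive definite, then the subspaces $Ran(A_1),\ldots,Ran(A_n)$ are essentially linearly independent and their sum $\sum_{k=1}^n Ran(A_k)=\{\sum_{k=1}^n A_kx_k\mid x_k\in\mathcal{H}_k\}$ is closed in $\mathcal{H}$.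
   Context: For a bounded linear operator $T:\mathcal{X}\to\mathcal{Y}$ between Hilbert spaces, $\|T\|_e=\inf\{\|T+K\|\mid K:\mathcal{X}\to\mathcal{Y}\text{ compact}\}$ is the essential norm. Essential reduced minimum modulus: for a bounded linear operator $A:\mathcal{H}_1\to\mathcal{H}_2$ with $A\neq 0$, let $B=A^*A\upharpoonright_{\mathcal{H}_1\ominus Ker(A)}$, viewed as a self-adjoint operator on $\mathcal{H}_1\ominus Ker(A)$; then $\gamma_e(A)$ is the supremum of all $\gamma\geqslant 0$ for which there exists a compact self-adjoint operator $K$ on $\mathcal{H}_1\ominus Ker(A)$ with $B+K\geqslant\gamma^2 I$ (so $\gamma_e(A)=+\infty$ if $\mathcal{H}_1\ominus Ker(A)$ is finite dimensional); for the zero operator, $\gamma_e(0)=+\infty$. Subspaces $\mathcal{X}_1,\ldots,\mathcal{X}_n$ of a Hilbert space $\mathcal{X}$ are called essentially linearly independent if the linear set $\mathcal{X}_i\cap\sum_{j\neq i}\mathcal{X}_j$ is finite dimensional for every $i=1,\ldots,n$. *)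

(* Defs.v *)
From HB Require Import structures.
From mathcomp Require Import all_boot all_order all_algebra.
From mathcomp Require Import complex.
From mathcomp Require Import boolp classical_sets reals constructive_ereal ereal.
Set Implicit Arguments. Unset Strict Implicit. Unset Printing Implicit Defensive.
Import Order.TTheory GRing.Theory Num.Theory.
Local Open Scope ring_scope.
Local Open Scope classical_set_scope.

Record hilbertSpace (R : realType) := HilbertSpace {
  hcarrier :> lmodType R[i];
  hip : hcarrier -> hcarrier -> R[i];
  hip_linl : forall (a : R[i]) (x y z : hcarrier),
      hip (a *: x + y) z = a * hip x z + hip y z;
  hip_conj : forall x y : hcarrier, hip y x = conjc (hip x y);
  hip_ge0 : forall x : hcarrier, 0 <= hip x x;
  hip_eq0 : forall x : hcarrier, hip x x = 0 -> x = 0;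
  hcomplete : forall u : nat -> hcarrier,
      (forall e : R, 0 < e -> exists N : nat, forall m k : nat, (N <= m)%N -> (N <= k)%N ->
          Num.sqrt (@complex.Re R (hip (u m - u k) (u m - u k))) < e) ->
      exists v : hcarrier, forall e : R, 0 < e -> exists N : nat, forall m : nat, (N <= m)%N ->
          Num.sqrt (@complex.Re R (hip (u m - v) (u m - v))) < e
}.

Section Hilbert.
Variable R : realType.

Definition hnorm (H : hilbertSpace R) (x : H) : R := Num.sqrt (@complex.Re R (hip x x)).

Definition hconv (H : hilbertSpace R) (u : nat -> H) (v : H) : Prop :=
  forall e : R, 0 < e -> exists N : nat, forall m : nat, (N <= m)%N -> hnorm (u m - v) < e.

Definition hclosed (H : hilbertSpace R) (S : set H) : Prop :=
  forall v : H, (forall e : R, 0 < e -> exists2 w, S w & hnorm (v - w) < e) -> S v.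

Definition hfinite_dim (H : hilbertSpace R) (S : set H) : Prop :=
  exists s : seq H, forall v, S v ->
    exists c : nat -> R[i], v = \sum_(k < size s) c k *: nth 0 s k.

Definition hlinear (H1 H2 : hilbertSpace R) (T : H1 -> H2) : Prop :=
  forall (a : R[i]) (x y : H1), T (a *: x + y) = a *: T x + T y.

Definition bounded_op (H1 H2 : hilbertSpace R) (T : H1 -> H2) : Prop :=
  hlinear T /\ exists C : R, forall x : H1, hnorm (T x) <= C * hnorm x.

Definition is_adjoint (H1 H2 : hilbertSpace R) (A : H1 -> H2) (B : H2 -> H1) : Prop :=
  forall (x : H1) (y : H2), hip (A x) y = hip x (B y).

Definition compact_on (H1 H2 : hilbertSpace R) (D : set H1) (T : H1 -> H2) : Prop :=
  forall u : nat -> H1, (forall m, D (u m)) ->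
    (exists C : R, forall m, hnorm (u m) <= C) ->
    exists (phi : nat -> nat) (y : H2),
      (forall m, (phi m < phi m.+1)%N) /\ hconv (fun m => T (u (phi m))) y.

Definition compact_op (H1 H2 : hilbertSpace R) (T : H1 -> H2) : Prop :=
  bounded_op T /\ compact_on setT T.

Definition opnorm (H1 H2 : hilbertSpace R) (T : H1 -> H2) : \bar R :=
  ereal_sup [set (hnorm (T x))%:E | x in [set x : H1 | hnorm x <= 1]].

Definition essnorm (H1 H2 : hilbertSpace R) (T : H1 -> H2) : \bar R :=
  ereal_inf [set opnorm (fun x => T x + K x) |
             K in [set K : H1 -> H2 | compact_op K]].

Definition kerA_perp (H1 H2 : hilbertSpace R) (A : H1 -> H2) : set H1 :=
  [set x | forall y : H1, A y = 0 -> hip x y = 0].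

(* essential reduced minimum modulus; As is the adjoint of A.
   K ranges over compact self-adjoint operators on S = H1 (-) Ker(A),
   represented as maps H1 -> H1 leaving S invariant (only K|_S matters). *)
Definition gamma_e (H1 H2 : hilbertSpace R) (A : H1 -> H2) (As : H2 -> H1) : \bar R :=
  if `[< forall x : H1, A x = 0 >] then +oo%E else
  let S := kerA_perp A in
  ereal_sup [set g%:E | g in [set g : R | 0 <= g /\
     exists K : H1 -> H1,
       (forall x, S x -> S (K x)) /\
       (forall (a : R[i]) x y, S x -> S y -> K (a *: x + y) = a *: K x + K y) /\
       compact_on S K /\
       (forall x y, S x -> S y -> hip (K x) y = hip x (K y)) /\
       (forall x, S x -> (g ^+ 2)%:C%C * hip x x <= hip (As (A x) + K x) x)]].

Definition sum_except (H : hilbertSpace R) (n : nat) (X : 'I_n -> set H) (i : 'I_n) : set H :=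
  [set v | exists x : 'I_n -> H, (forall j, X j (x j)) /\ v = \sum_(j < n | j != i) x j].

Definition ess_lin_indep (H : hilbertSpace R) (n : nat) (X : 'I_n -> set H) : Prop :=
  forall i : 'I_n, hfinite_dim (X i `&` sum_except X i).

Definition posdef (n : nat) (M : 'M[R]_n) : Prop :=
  M^T = M /\ forall v : 'rV[R]_n, v != 0 -> 0 < (v *m M *m v^T) 0 0.

End Hilbert.

(* Main.v *)
Require Import Defs.
From HB Require Import structures.
From mathcomp Require Import all_boot all_order all_algebra.
From mathcomp Require Import complex.
From mathcomp Require Import boolp classical_sets reals constructive_ereal ereal.
From mathcomp Require Import ring lra.
Set Implicit Arguments. Unset Strict Implicit. Unset Printing Implicit Defensive.
Import Order.TTheory GRing.Theory Num.Theory.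
Local Open Scope ring_scope.
Local Open Scope classical_set_scope.

(** Let [S_k] be the orthogonal complement of [Ker(A_k)] and [T x = \sum_k A_k x_k] on
    the direct sum of the [S_k]. Choosing compact operators that nearly realise
    [gamma_e] and the essential norms, and using that [M] stays coercive under
    a small perturbation, one gets [c |x|^2 <= |T x|^2 + |x| \sum |K_ij x_j|] with [c > 0]
    and all [K_ij] compact. Hence a bounded sequence whose image under [T] is
    Cauchy has a Cauchy subsequence. Consequently the kernel of [T] is finite
    dimensional, which gives essential independence, and [T] is bounded below
    on the complement of its kernel, which gives the closed range. *)

(** * Real part of the inner product, and the norm *)

Definition rip {R : realType} {H : hilbertSpace R} (x y : H) : R :=
  @complex.Re R (hip x y).

Section InnerProduct.
Context {R : realType} {H : hilbertSpace R}.
Implicit Types (x y z : H) (a b : R[i]) (t : R).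

Lemma hipDl x y z : hip (x + y) z = hip x z + hip y z.
Proof. by have := hip_linl 1 x y z; rewrite scale1r mul1r. Qed.

Lemma hip0l z : hip (0 : H) z = 0.
Proof. by apply: (addrI (hip 0 z)); rewrite -hipDl !addr0. Qed.

Lemma hipZl a x z : hip (a *: x) z = a * hip x z.
Proof. by have := hip_linl a x 0 z; rewrite !addr0 hip0l addr0. Qed.

Lemma hipNl x z : hip (- x) z = - hip x z.
Proof. by rewrite -scaleN1r hipZl mulN1r. Qed.

Lemma hipDr x y z : hip x (y + z) = hip x y + hip x z.
Proof. by rewrite hip_conj hipDl rmorphD /= -!hip_conj. Qed.

Lemma hipZr a x z : hip x (a *: z) = conjc a * hip x z.
Proof. by rewrite hip_conj hipZl rmorphM /= -!hip_conj. Qed.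

Lemma hip0r x : hip x (0 : H) = 0.
Proof. by rewrite hip_conj hip0l conjc0. Qed.

Lemma hip_suml (I : finType) (F : I -> H) z :
  hip (\sum_i F i) z = \sum_i hip (F i) z.
Proof. by apply: (big_morph (fun x => hip x z)) => [x y|]; rewrite ?hipDl ?hip0l. Qed.

Lemma ripC x y : rip x y = rip y x.
Proof. by rewrite /rip hip_conj; case: (hip y x). Qed.

Lemma ripDl x y z : rip (x + y) z = rip x z + rip y z.
Proof. by rewrite /rip hipDl; case: (hip x z); case: (hip y z). Qed.

Lemma ripDr x y z : rip x (y + z) = rip x y + rip x z.
Proof. by rewrite ripC ripDl ripC [rip z x]ripC. Qed.

Lemma ripZl t x z : rip (t%:C%C *: x) z = t * rip x z.
Proof. by rewrite /rip hipZl; case: (hip x z) => u v /=; rewrite mul0r subr0. Qed.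

Lemma ripZr t x z : rip x (t%:C%C *: z) = t * rip x z.
Proof. by rewrite ripC ripZl ripC. Qed.

Lemma ripNl x z : rip (- x) z = - rip x z.
Proof. by rewrite /rip hipNl; case: (hip x z). Qed.

Lemma ripNr x z : rip x (- z) = - rip x z.
Proof. by rewrite ripC ripNl ripC. Qed.

Lemma rip0l z : rip (0 : H) z = 0.
Proof. by rewrite /rip hip0l. Qed.

Lemma rip0r z : rip z (0 : H) = 0.
Proof. by rewrite /rip hip0r. Qed.

Lemma rip_suml (I : finType) (F : I -> H) z :
  rip (\sum_i F i) z = \sum_i rip (F i) z.
Proof. by apply: (big_morph (fun x => rip x z)) => [x y|]; rewrite ?ripDl ?rip0l. Qed.

Lemma rip_sumr (I : finType) (F : I -> H) z :
  rip z (\sum_i F i) = \sum_i rip z (F i).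
Proof. by rewrite ripC rip_suml; apply: eq_bigr => i _; rewrite ripC. Qed.

Lemma rip_ge0 x : 0 <= rip x x.
Proof. by have := hip_ge0 x; rewrite lecE => /andP[]. Qed.

Lemma hip_rip x : hip x x = (rip x x)%:C%C.
Proof.
rewrite /rip; have := hip_ge0 x; rewrite lecE => /andP[/eqP].
by case: (hip x x) => u v /= ->.
Qed.

Lemma hnorm_sqr x : hnorm x ^+ 2 = rip x x.
Proof. by rewrite /hnorm sqr_sqrtr ?rip_ge0. Qed.

Lemma hnorm_ge0 x : 0 <= hnorm x.
Proof. exact: sqrtr_ge0. Qed.

Lemma hnorm0 : hnorm (0 : H) = 0.
Proof. by rewrite /hnorm hip0l sqrtr0. Qed.

Lemma hnorm0_eq0 x : hnorm x = 0 -> x = 0.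
Proof.
by move=> nx; apply: hip_eq0; rewrite hip_rip -hnorm_sqr nx expr0n.
Qed.

Lemma hnormZ t x : hnorm (t%:C%C *: x) = `|t| * hnorm x.
Proof.
apply/eqP; rewrite -(@eqrXn2 _ 2) ?mulr_ge0 ?hnorm_ge0 //.
by rewrite exprMn !hnorm_sqr ripZl ripZr mulrA -expr2 -normrX ger0_norm ?sqr_ge0.
Qed.

Lemma hnormN x : hnorm (- x) = hnorm x.
Proof.
apply/eqP; rewrite -(@eqrXn2 _ 2) ?hnorm_ge0 //.
by rewrite !hnorm_sqr ripNl ripNr opprK.
Qed.

Lemma hnormB x y : hnorm (x - y) = hnorm (y - x).
Proof. by rewrite -hnormN opprB. Qed.

(** Cauchy-Schwarz: expanding [| |y| x - |x| y |^2 >= 0] gives [2 |x||y| (|x||y| - rip x y) >= 0],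
    and [|x||y|] is cancelled once both vectors are nonzero. *)
Lemma rip_le x y : rip x y <= hnorm x * hnorm y.
Proof.
have [/hnorm0_eq0->|nx] := eqVneq (hnorm x) 0; first by rewrite rip0l hnorm0 mul0r.
have [/hnorm0_eq0->|ny] := eqVneq (hnorm y) 0; first by rewrite rip0r hnorm0 mulr0.
have px : 0 < hnorm x by rewrite lt_def nx hnorm_ge0.
have py : 0 < hnorm y by rewrite lt_def ny hnorm_ge0.
have := rip_ge0 ((hnorm y)%:C%C *: x - (hnorm x)%:C%C *: y).
rewrite !(ripDl, ripDr, ripNl, ripNr, ripZl, ripZr) -!hnorm_sqr [rip y x]ripC => h.
rewrite -(@ler_pM2l _ (hnorm x * hnorm y)) ?mulr_gt0 //; nra.
Qed.

Lemma norm_rip_le x y : `|rip x y| <= hnorm x * hnorm y.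
Proof. by rewrite ler_norml rip_le andbT lerNl -ripNl -(hnormN x) rip_le. Qed.

Lemma hnormD x y : hnorm (x + y) <= hnorm x + hnorm y.
Proof.
rewrite -ler_sqr ?nnegrE ?addr_ge0 ?hnorm_ge0 //.
rewrite hnorm_sqr !(ripDl, ripDr) -!hnorm_sqr [rip y x]ripC.
by have := rip_le x y; nra.
Qed.

Lemma hnorm_tri z x y : hnorm (x - y) <= hnorm (x - z) + hnorm (z - y).
Proof. by apply: le_trans (hnormD _ _); rewrite addrA subrK. Qed.

Lemma hnorm_triB x y : hnorm (x - y) <= hnorm x + hnorm y.
Proof. by rewrite -(hnormN y) hnormD. Qed.

Lemma parallelogram x y :
  hnorm (x - y) ^+ 2 = 2 * hnorm x ^+ 2 + 2 * hnorm y ^+ 2 - hnorm (x + y) ^+ 2.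
Proof. by rewrite !hnorm_sqr !(ripDl, ripDr, ripNl, ripNr) [rip y x]ripC; ring. Qed.

(** The real part of [hip x ('i *: y)] is the imaginary part of [hip x y]. Complex orthogonality to
    a subspace thus reduces to real orthogonality, where inequalities over [R] apply. *)
Lemma hip0_rip x y : rip x y = 0 -> rip x ('i%C *: y) = 0 -> hip x y = 0.
Proof.
rewrite /rip hipZr; case: (hip x y) => u v /= -> /=.
by rewrite !mul0r mulN1r sub0r opprK => ->.
Qed.

End InnerProduct.

(** * Linear maps and adjoints *)

Section LinearMaps.
Context {R : realType} {H1 H2 : hilbertSpace R} {T : H1 -> H2}.
Hypothesis linT : hlinear T.

Lemma hlin0 : T 0 = 0.
Proof.
by have := linT 1 0 0; rewrite !scale1r addr0 => h; apply: (addrI (T 0)); rewrite -h addr0.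
Qed.

Lemma hlinD x y : T (x + y) = T x + T y.
Proof. by have := linT 1 x y; rewrite !scale1r. Qed.

Lemma hlinZ a x : T (a *: x) = a *: T x.
Proof. by have := linT a x 0; rewrite !addr0 hlin0 addr0. Qed.

Lemma hlinN x : T (- x) = - T x.
Proof. by rewrite -scaleN1r hlinZ scaleN1r. Qed.

Lemma hlinB x y : T (x - y) = T x - T y.
Proof. by rewrite hlinD hlinN. Qed.

Lemma hlin_sum (I : finType) (F : I -> H1) : T (\sum_i F i) = \sum_i T (F i).
Proof. exact: (big_morph T hlinD hlin0). Qed.

End LinearMaps.

(** The linearity defect of [B] is orthogonal to every vector, hence to itself. *)
Lemma adjoint_linear {R : realType} {H1 H2 : hilbertSpace R}
    (A : H1 -> H2) (B : H2 -> H1) :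
  is_adjoint A B -> hlinear B.
Proof.
move=> adjB a x y; apply/eqP; rewrite -subr_eq0; apply/eqP/hip_eq0.
set z := _ - _; have zE w : hip w z = 0.
  rewrite /z -scaleN1r hipDr hipZr !hipDr !hipZr -!adjB hipDr hipZr.
  by rewrite rmorphN1 mulN1r subrr.
exact: zE.
Qed.

(** * Sequences, subspaces and limits *)

Section Sequences.
Context {R : realType}.

Definition hcauchy {H : hilbertSpace R} (u : nat -> H) : Prop :=
  forall e : R, 0 < e -> exists N : nat, forall m k : nat,
    (N <= m)%N -> (N <= k)%N -> hnorm (u m - u k) < e.

Definition subspace {H : hilbertSpace R} (S : set H) : Prop :=
  S 0 /\ forall a x y, S x -> S y -> S (a *: x + y).

Definition seq_closed {H : hilbertSpace R} (S : set H) : Prop :=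
  forall u v, (forall m, S (u m)) -> hconv u v -> S v.

Lemma inv_nat_small (e : R) : 0 < e -> exists N : nat, forall m : nat, (N <= m)%N -> m.+1%:R^-1 < e.
Proof.
move=> e0; exists (Num.truncn e^-1) => m Nm.
rewrite -[ltRHS]invrK ltf_pV2 ?posrE ?invr_gt0 ?ltr0Sn //.
apply: lt_le_trans (truncnS_gt _) _.
by rewrite ler_nat ltnS.
Qed.

Lemma increasing_ge_id (phi : nat -> nat) :
  (forall m, (phi m < phi m.+1)%N) -> forall m, (m <= phi m)%N.
Proof. by move=> inc; elim=> // m IH; apply: leq_ltn_trans IH (inc m). Qed.

Context {H : hilbertSpace R}.
Implicit Types (u : nat -> H) (v w : H) (S : set H).

Lemma subspaceD S x y : subspace S -> S x -> S y -> S (x + y).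
Proof. by move=> [_ cl] Sx Sy; rewrite -[x]scale1r; apply: cl. Qed.

Lemma subspaceZ S a x : subspace S -> S x -> S (a *: x).
Proof. by move=> [S0 cl] Sx; rewrite -[_ *: _]addr0; apply: cl. Qed.

Lemma subspaceB S x y : subspace S -> S x -> S y -> S (x - y).
Proof. by move=> [_ cl] Sx Sy; rewrite addrC -scaleN1r; apply: cl. Qed.

Lemma subspace_sum S (I : finType) (F : I -> H) :
  subspace S -> (forall i, S (F i)) -> S (\sum_i F i).
Proof.
move=> sS SF; apply: (big_ind S); first by case: sS.
- by move=> x y; apply: subspaceD.
- by move=> i _; apply: SF.
Qed.

Lemma hcauchy_conv u : hcauchy u -> exists v, hconv u v.
Proof. exact: hcomplete. Qed.

Lemma hconv_cauchy u v : hconv u v -> hcauchy u.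
Proof.
move=> cuv e e0; have [|N hN] := cuv (e / 2); first lra.
exists N => m k Nm Nk; apply: le_lt_trans (hnorm_tri v _ _) _.
by have := hN m Nm; have := hN k Nk; rewrite (hnormB v); lra.
Qed.

Lemma hcauchy_sub u (phi : nat -> nat) :
  (forall m, (phi m < phi m.+1)%N) -> hcauchy u -> hcauchy (u \o phi).
Proof.
move=> inc cu e e0; have [N hN] := cu e e0; exists N => m k Nm Nk /=.
by apply: hN; apply: leq_trans (increasing_ge_id inc _).
Qed.

Lemma hconv_sub u v (phi : nat -> nat) :
  (forall m, (phi m < phi m.+1)%N) -> hconv u v -> hconv (u \o phi) v.
Proof.
move=> inc cu e e0; have [N hN] := cu e e0; exists N => m Nm /=.
by apply: hN; apply: leq_trans (increasing_ge_id inc _).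
Qed.

Lemma hconv_unique u v w : hconv u v -> hconv u w -> v = w.
Proof.
move=> cv cw; apply/eqP; rewrite -subr_eq0; apply/eqP/hnorm0_eq0/eqP.
rewrite eq_le hnorm_ge0 andbT; apply/ler_addgt0Pr => e e0; rewrite add0r.
have [|N hN] := cv (e / 2); first lra.
have [|M hM] := cw (e / 2); first lra.
have := hN _ (leq_maxl N M); have := hM _ (leq_maxr N M).
set z := u _ => h1 h2; apply: le_trans (hnorm_tri z _ _) _.
by rewrite (hnormB v); lra.
Qed.

(** The hypothesis is a bound on the limsup of the norms, which is what a minimising sequence
    provides. *)
Lemma hconv_norm_le u v (c : R) :
    (forall e, 0 < e -> exists N, forall m, (N <= m)%N -> hnorm (u m) <= c + e) ->
  hconv u v -> hnorm v <= c.
Proof.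
move=> bu cv; apply/ler_addgt0Pr => e e0.
have [|N hN] := cv (e / 2); first lra.
have [|M hM] := bu (e / 2); first lra.
have := hN _ (leq_maxl N M); have := hM _ (leq_maxr N M).
set z := u _ => h1 h2; have := hnorm_triB z (z - v).
by rewrite opprB addrC subrK; lra.
Qed.

Lemma hconv_norm_ge u v (c : R) :
  (forall m, c <= hnorm (u m)) -> hconv u v -> c <= hnorm v.
Proof.
move=> bu cv; apply/ler_addgt0Pr => e e0.
have [N hN] := cv e e0; have := hN _ (leqnn N); have := bu N.
by have := hnormD (u N - v) v; rewrite subrK; lra.
Qed.

Lemma rip_conv0 u v w : hconv u v -> (forall m, rip (u m) w = 0) -> rip v w = 0.
Proof.
move=> cv h; apply/eqP; rewrite -normr_eq0 eq_le normr_ge0 andbT.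
apply/ler_addgt0Pr => e e0; rewrite add0r.
have w1 : 0 < hnorm w + 1 by have := hnorm_ge0 w; lra.
have [|N hN] := cv (e / (hnorm w + 1)); first by rewrite divr_gt0.
have := norm_rip_le (u N - v) w.
rewrite ripDl ripNl h sub0r normrN => /le_trans; apply.
have := hN _ (leqnn N); rewrite ltr_pdivlMr // => /ltW; apply: le_trans.
by rewrite ler_wpM2l ?hnorm_ge0 // lerDl.
Qed.

End Sequences.

(** * Bounded operators and least-norm preimages *)

Section BoundedOperators.
Context {R : realType} {G H : hilbertSpace R}.
Implicit Types (T : G -> H) (S : set G).

Lemma bounded_hconv T u v : bounded_op T -> hconv u v -> hconv (T \o u) (T v).
Proof.
move=> [linT [C bT]] cv e e0.
have C1 : 0 < `|C| + 1 by rewrite ltr_wpDl.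
have [|N hN] := cv (e / (`|C| + 1)); first by rewrite divr_gt0.
exists N => m /hN; rewrite ltr_pdivlMr //= => hm; rewrite -(hlinB linT).
apply: le_lt_trans (bT _) (le_lt_trans _ hm); rewrite mulrC.
by rewrite ler_wpM2l ?hnorm_ge0 // (le_trans (ler_norm C)) // lerDl.
Qed.

(** First-variation test, applied below to [t |-> |p + t w|^2 - |p|^2] at a least-norm element
    [p]. *)
Lemma linear_term_eq0 (b c : R) :
  0 <= c -> (forall t : R, 0 <= 2 * t * b + t ^+ 2 * c) -> b = 0.
Proof.
(* The parabola has its minimum at [- b / c]; replacing [c] by [c + 1] avoids a zero denominator and
   still gives a negative value unless [b = 0]. *)
move=> c0 /(_ (- b / (c + 1))).
have c1 : 0 < c + 1 by lra.
have -> : 2 * (- b / (c + 1)) * b + (- b / (c + 1)) ^+ 2 * c =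
  - (b ^+ 2 * (c + 2) / (c + 1) ^+ 2) by field; lra.
rewrite oppr_ge0 pmulr_lle0 ?invr_gt0 ?exprn_gt0 // pmulr_lle0; last lra.
by move=> h; apply/eqP; rewrite -sqrf_eq0 eq_le h sqr_ge0.
Qed.

(* The element of least norm in the fibre of [T] through [x]. *)
Lemma orthogonal_lift S T x :
    subspace S -> seq_closed S -> bounded_op T -> S x ->
  exists p, [/\ S p, T p = T x & forall y, S y -> T y = 0 -> hip p y = 0].
Proof.
move=> sS cS bT Sx; have linT := bT.1.
pose D := [set hnorm y | y in [set y | S y /\ T y = T x]].
pose d := inf D.
have dlb y : S y -> T y = T x -> d <= hnorm y.
  move=> Sy Ty; apply: ge_inf; last by exists y.
  by exists 0 => _ [z _ <-]; apply: hnorm_ge0.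
have hiD : has_inf D.
  split; first by exists (hnorm x), x.
  by exists 0 => _ [z _ <-]; apply: hnorm_ge0.
have d0 : 0 <= d by apply: lb_le_inf; [exact: hiD.1|move=> _ [z _ <-]; exact: hnorm_ge0].
have /choice [u hu] (m : nat) : exists y, [/\ S y, T y = T x & hnorm y < d + m.+1%:R^-1].
  have [|_ [y [Sy Ty] <-] h] := @inf_adherent _ D m.+1%:R^-1 _ hiD.
    by rewrite invr_gt0 ltr0Sn.
  by exists y.
have Su m : S (u m) by case: (hu m).
have Tu m : T (u m) = T x by case: (hu m).
have nu m : hnorm (u m) < d + m.+1%:R^-1 by case: (hu m).
(* The midpoint of [u m] and [u k] stays in the fibre, so its norm is at least [d]. With both norms
   at most [d + r], the parallelogram law bounds [|u m - u k|^2] by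
   [4 (d + r)^2 - 4 d^2 = 8 d r + 4 r^2], which is at most [(8 d + 4) r] since [r <= 1]. *)
have cu : hcauchy u.
  move=> e e0.
  have d8 : 0 < 8 * d + 4 by lra.
  have [|N hN] := @inv_nat_small _ (e ^+ 2 / (8 * d + 4)).
    by rewrite divr_gt0 ?exprn_gt0.
  exists N => m k Nm Nk; rewrite -ltr_sqr ?nnegrE ?hnorm_ge0 ?ltW // parallelogram.
  pose r : R := N.+1%:R^-1.
  have r1 : r <= 1 by rewrite invf_le1 ?ltr0Sn // ler1n.
  have r0 : 0 < r by rewrite invr_gt0 ltr0Sn.
  have hr := hN N (leqnn N); rewrite -/r ltr_pdivlMr // in hr.
  have small l : (N <= l)%N -> hnorm (u l) <= d + r.
    move=> Nl; apply: ltW; apply: lt_le_trans (nu l) _; rewrite lerD2l.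
    by rewrite lef_pV2 ?posrE ?ltr0Sn // ler_nat ltnS.
  have := small m Nm; have := small k Nk.
  have := hnorm_ge0 (u m); have := hnorm_ge0 (u k).
  have : d <= 2^-1 * hnorm (u m + u k).
    have <- : hnorm ((2^-1)%:C%C *: (u m + u k)) = 2^-1 * hnorm (u m + u k).
      by rewrite hnormZ ger0_norm ?invr_ge0.
    apply: dlb; first by apply: subspaceZ => //; apply: subspaceD.
    rewrite (hlinZ linT) (hlinD linT) !Tu -mulr2n -scaler_nat scalerA.
    by rewrite -[2 in X in _ * X](rmorph_nat (real_complex R)) -rmorphM /= mulVf ?pnatr_eq0 // scale1r.
  nra.
have [p up] := hcauchy_conv cu.
have Sp : S p by apply: cS up.
have Tp : T p = T x.
  apply: (hconv_unique (bounded_hconv bT up)) => e e0; exists 0%N => m _ /=.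
  by rewrite Tu subrr hnorm0.
have np : hnorm p <= d.
  apply: hconv_norm_le up => e e0; have [N hN] := inv_nat_small e0.
  by exists N => m /hN h; apply: ltW; apply: lt_trans (nu m) _; rewrite ltrD2l.
exists p; split=> // y Sy Ty.
(* Adding a multiple of [w] to [p] does not leave the fibre, so minimality of [p] makes the first
   variation along [w] vanish. *)
have perp w : S w -> T w = 0 -> rip p w = 0.
  move=> Sw Tw; apply: (@linear_term_eq0 _ (rip w w)); first exact: rip_ge0.
  move=> t; have : d <= hnorm (t%:C%C *: w + p).
    by apply: dlb; [apply: sS.2|rewrite linT Tw scaler0 add0r].
  move=> /(le_trans np); rewrite -ler_sqr ?nnegrE ?hnorm_ge0 // !hnorm_sqr.
  by rewrite !(ripDl, ripDr, ripZl, ripZr) [rip w p]ripC; nra.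
by apply: hip0_rip; apply: perp => //; [apply: subspaceZ|rewrite (hlinZ linT) Ty scaler0].
Qed.

End BoundedOperators.

(** * A compactness criterion for finite dimension *)

Section FiniteDimension.
Context {R : realType} {H : hilbertSpace R}.

(** Gram-Schmidt: no finite list spans [E], so an orthonormal list in [E] can always be extended by
    the normalised residual of a vector outside its span. *)
Lemma orthonormal_sequence (E : set H) :
    subspace E -> ~ hfinite_dim E ->
  exists u : nat -> H, (forall m, E (u m)) /\
    forall m k, hip (u m) (u k) = (m == k)%:R.
Proof.
move=> sE nfE.
pose good (s : seq H) := (forall i, (i < size s)%N -> E (nth 0 s i)) /\
  forall i j, (i < size s)%N -> (j < size s)%N -> hip (nth 0 s i) (nth 0 s j) = (i == j)%:R.
(* The condition on [s] sits under the existential so that [choice] yields one function on all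
   lists; lists that are not [good] receive 0. *)
have ext (s : seq H) : exists x, good s -> good (rcons s x).
  have [[Es os]|ngs] := pselect (good s); last by exists 0.
  have [v Ev nv] : exists2 v, E v & forall c : nat -> R[i],
      v <> \sum_(k < size s) c k *: nth 0 s k.
    apply: contrapT => nex; apply: nfE; exists s => v Ev.
    apply: contrapT => nc; apply: nex; exists v => // c vE; apply: nc; exists c.
    exact: vE.
  pose w := v - \sum_(k < size s) hip v (nth 0 s k) *: nth 0 s k.
  have Ew : E w.
    by apply: subspaceB => //; apply: subspace_sum => // i; apply: subspaceZ => //; apply: Es.
  have w0 : hnorm w != 0.
    apply/eqP => /hnorm0_eq0/eqP; rewrite subr_eq0 => /eqP.
    exact: (nv (fun k => hip v (nth 0 s k))).
  have wp j : (j < size s)%N -> hip w (nth 0 s j) = 0.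
    move=> js; rewrite hipDl hipNl hip_suml (bigD1 (Ordinal js)) //= big1 ?addr0.
      by rewrite hipZl os // eqxx mulr1 subrr.
    by move=> i; rewrite hipZl -val_eqE /= os // => /negbTE ->; rewrite mulr0.
  pose x := ((hnorm w)^-1)%:C%C *: w.
  have xp j : (j < size s)%N -> hip x (nth 0 s j) = 0.
    by move=> js; rewrite hipZl wp ?mulr0.
  have xx : hip x x = 1.
    by rewrite hip_rip ripZl ripZr -hnorm_sqr expr2 mulKf // mulVf.
  exists x => _; split => [i|i j]; rewrite size_rcons !ltnS => hi.
    by rewrite nth_rcons; case: ltngtP hi => // [? _|_ _]; [apply: Es|apply: subspaceZ].
  move=> hj; rewrite !nth_rcons.
  case: (ltngtP i (size s)) hi => // [hi|hi] _; case: (ltngtP j (size s)) hj => // [hj|hj] _.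
  - exact: os.
  - by rewrite hip_conj xp // conjc0 hj ltn_eqF.
  - by rewrite xp // hi gtn_eqF.
  - by rewrite xx hi hj eqxx.
have [f hf] := choice ext.
(* Course-of-values recursion: each [u m] is chosen from the list [L m] of its predecessors, and
   lists only grow at the end, so earlier terms never change. *)
pose L m := iter m (fun s => rcons s (f s)) [::].
pose u m := f (L m).
have LE m : L m = mkseq u m.
  by elim: m => // m IH; rewrite mkseqS -IH.
have gL m : good (L m) by elim: m => [|m IH]; [split|exact: hf].
have Lk m k : (k < m)%N -> nth 0 (L m) k = u k by move=> km; rewrite LE nth_mkseq.
have sL m : size (L m) = m by rewrite LE size_mkseq.
exists u; split => [m|m k].
  by rewrite -(Lk m.+1 m) //; apply: (gL m.+1).1; rewrite sL.
pose N := (maxn m k).+1.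
have mN : (m < N)%N by rewrite ltnS leq_maxl.
have kN : (k < N)%N by rewrite ltnS leq_maxr.
by rewrite -(Lk N m) // -(Lk N k) //; apply: (gL N).2; rewrite sL.
Qed.

(** Distinct terms of an orthonormal sequence have squared distance 2, so none of its subsequences
    is Cauchy. *)
Lemma finite_dim_of_compact (E : set H) :
    subspace E ->
    (forall u : nat -> H, (forall m, E (u m)) -> (exists C : R, forall m, hnorm (u m) <= C) ->
      exists phi : nat -> nat, (forall m, (phi m < phi m.+1)%N) /\ hcauchy (u \o phi)) ->
  hfinite_dim E.
Proof.
move=> sE cE; apply: contrapT => /(orthonormal_sequence sE) [u [Eu ou]].
have ru m k : rip (u m) (u k) = (m == k)%:R by rewrite /rip ou; case: eqP.
have nu m : hnorm (u m) = 1.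
  by rewrite /hnorm ou eqxx /= sqrtr1.
have [|phi [inc cu]] := cE u Eu; first by exists 1 => m; rewrite nu.
have [N /(_ N N.+1 (leqnn _) (leqnSn _)) /=] := cu 1 ltr01.
rewrite -(@ltr_sqr _ _ 1) ?nnegrE ?hnorm_ge0 // hnorm_sqr.
rewrite !(ripDl, ripDr, ripNl, ripNr) !ru !eqxx ltn_eqF // gtn_eqF //=; lra.
Qed.

End FiniteDimension.

(** * Operators proper on bounded sets: kernel and range *)

Section ProperMaps.
Context {R : realType} {G H : hilbertSpace R}.

(** For a bounded operator on a closed subspace this is the sequential form of the upper
    semi-Fredholm property: finite-dimensional kernel and closed range. *)
Definition proper_on (S : set G) (T : G -> H) : Prop :=
  forall u : nat -> G, (forall m, S (u m)) -> (exists C : R, forall m, hnorm (u m) <= C) ->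
    hcauchy (T \o u) ->
    exists phi : nat -> nat, (forall m, (phi m < phi m.+1)%N) /\ hcauchy (u \o phi).

Variables (S : set G) (T : G -> H).
Hypotheses (sS : subspace S) (cS : seq_closed S) (bT : bounded_op T)
  (pT : proper_on S T).
Let linT := bT.1.

Lemma proper_kernel_finite_dim : hfinite_dim (S `&` [set x | T x = 0]).
Proof.
apply: finite_dim_of_compact.
  split; first by split; [apply: sS.1|apply: hlin0].
  move=> a x y [Sx Tx] [Sy Ty]; split; first exact: sS.2.
  by rewrite /= linT Tx Ty scaler0 addr0.
move=> u Eu bu; apply: pT => // [m|e e0]; first by case: (Eu m).
by exists 0%N => m k _ _ /=; rewrite (Eu m).2 (Eu k).2 subrr hnorm0.
Qed.

Definition reduced : set G :=
  S `&` [set x | forall y, S y -> T y = 0 -> hip x y = 0].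

(** Otherwise there are unit vectors of [reduced] whose images tend to 0. Properness yields a
    convergent subsequence; its limit [z] has norm at least 1 and lies in the kernel, yet every term
    is orthogonal to the kernel, so [z] is orthogonal to itself. *)
Lemma proper_bounded_below :
  exists2 c : R, 0 < c & forall x, reduced x -> c * hnorm x <= hnorm (T x).
Proof.
apply: contrapT => nex.
have /choice [u hu] (m : nat) :
    exists x, [/\ reduced x, hnorm x = 1 & hnorm (T x) < m.+1%:R^-1].
  apply: contrapT => nx; apply: nex; exists m.+1%:R^-1; first by rewrite invr_gt0 ltr0Sn.
  move=> x [Sx px]; rewrite leNgt; apply/negP => hx; apply: nx.
  have x0 : 0 < hnorm x.
    rewrite lt_def hnorm_ge0 andbT; apply/eqP => x0.
    by move: hx; rewrite x0 mulr0 ltNge hnorm_ge0.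
  exists ((hnorm x)^-1%:C%C *: x); split.
  - split; first exact: subspaceZ.
    by move=> y Sy Ty; rewrite hipZl px ?mulr0.
  - by rewrite hnormZ ger0_norm ?invr_ge0 ?hnorm_ge0 // mulVf // gt_eqF.
  - rewrite (hlinZ linT) hnormZ ger0_norm ?invr_ge0 ?hnorm_ge0 //.
    by rewrite mulrC ltr_pdivrMr.
have Tu0 : hconv (T \o u) 0.
  move=> e /inv_nat_small[N hN]; exists N => m /hN; apply: lt_trans => /=.
  by rewrite subr0; case: (hu m).
have [||phi [inc]] := pT _ _ (hconv_cauchy Tu0).
- by move=> m; case: (hu m) => [[]].
- by exists 1 => m; case: (hu m) => [_ ->].
move=> /hcauchy_conv[z uz].
have Sz : S z by apply: cS uz => m; case: (hu (phi m)) => [[]].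
have Tz : T z = 0.
  exact: hconv_unique (bounded_hconv bT uz) (hconv_sub inc Tu0).
have z1 : 1 <= hnorm z by apply: hconv_norm_ge uz => m /=; case: (hu (phi m)) => [_ ->].
have : rip z z = 0.
  apply: (rip_conv0 uz) => m; rewrite /rip /=.
  by case: (hu (phi m)) => [[_ ->]].
by rewrite -hnorm_sqr => /eqP; rewrite sqrf_eq0 => /eqP h; move: z1; rewrite h ler10.
Qed.

(** Preimages of approximants are replaced by their orthogonal lifts, which lie in [reduced]. There
    the lower bound turns the convergent images into Cauchy preimages, whose limit is a preimage of
    [v]. *)
Lemma proper_range_closed : hclosed (T @` S).
Proof.
move=> v hv; have [c c0 hc] := proper_bounded_below.
have /choice [x hx] (m : nat) : exists x, reduced x /\ hnorm (v - T x) < m.+1%:R^-1.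
  have [|_ [x Sx <-] h] := hv m.+1%:R^-1; first by rewrite invr_gt0 ltr0Sn.
  have [p [Sp Tp pp]] := orthogonal_lift sS cS bT Sx.
  by exists p; rewrite Tp.
have Txv : hconv (T \o x) v.
  move=> e /inv_nat_small[N hN]; exists N => m /hN; apply: lt_trans => /=.
  by rewrite hnormB; case: (hx m).
have cx : hcauchy x.
  move=> e e0; have [N hN] := hconv_cauchy Txv (mulr_gt0 c0 e0).
  exists N => m k Nm Nk; rewrite -(ltr_pM2l c0); apply: le_lt_trans (hN m k Nm Nk).
  rewrite /= -(hlinB linT); apply: hc.
  have [[Sm pm] _] := hx m; have [[Sk pk] _] := hx k.
  split; first exact: subspaceB.
  by move=> y Sy Ty; rewrite hipDl hipNl pm ?pk ?subrr.
have [z xz] := hcauchy_conv cx; exists z.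
  by apply: cS xz => m; case: (hx m) => [[]].
exact: hconv_unique (bounded_hconv bT xz) Txv.
Qed.

End ProperMaps.

(** * The Hilbert direct sum of a finite family *)

Lemma uniform_rank (I : finType) (P : I -> nat -> Prop) :
    (forall i, exists N : nat, forall m, (N <= m)%N -> P i m) ->
  exists N : nat, forall i m, (N <= m)%N -> P i m.
Proof.
move=> /choice[N hN]; exists (\max_i N i)%N => i m Nm.
by apply: hN; apply: leq_trans Nm; apply: leq_bigmax.
Qed.

(** The dependent product is given a name so that the algebraic structures below can be attached to
    it. *)
Definition dsum (R : realType) (n : nat) (Hk : 'I_n -> hilbertSpace R) : Type :=
  forall k : 'I_n, Hk k.

Section DirectSum.
Context {R : realType} {n : nat} {Hk : 'I_n -> hilbertSpace R}.
Local Notation V := (dsum Hk).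
Implicit Types x y z : V.

Definition dsum_add x y : V := fun k => x k + y k.
Definition dsum_opp x : V := fun k => - x k.
Definition dsum_zero : V := fun k => 0.
Definition dsum_scale (a : R[i]) x : V := fun k => a *: x k.

Lemma dsum_addA : associative dsum_add.
Proof. by move=> x y z; apply: functional_extensionality_dep => k; apply: addrA. Qed.
Lemma dsum_addC : commutative dsum_add.
Proof. by move=> x y; apply: functional_extensionality_dep => k; apply: addrC. Qed.
Lemma dsum_add0 : left_id dsum_zero dsum_add.
Proof. by move=> x; apply: functional_extensionality_dep => k; apply: add0r. Qed.
Lemma dsum_addN : left_inverse dsum_zero dsum_opp dsum_add.
Proof. by move=> x; apply: functional_extensionality_dep => k; apply: addNr. Qed.

HB.instance Definition _ := gen_eqMixin V.
HB.instance Definition _ := gen_choiceMixin V.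
HB.instance Definition _ := GRing.isZmodule.Build V
  dsum_addA dsum_addC dsum_add0 dsum_addN.

Lemma dsum_scaleA a b x : dsum_scale a (dsum_scale b x) = dsum_scale (a * b) x.
Proof. by apply: functional_extensionality_dep => k; apply: scalerA. Qed.
Lemma dsum_scale1 : left_id 1 dsum_scale.
Proof. by move=> x; apply: functional_extensionality_dep => k; apply: scale1r. Qed.
Lemma dsum_scaleDr : right_distributive dsum_scale +%R.
Proof. by move=> a x y; apply: functional_extensionality_dep => k; apply: scalerDr. Qed.
Lemma dsum_scaleDl x : {morph dsum_scale^~ x : a b / a + b}.
Proof. by move=> a b; apply: functional_extensionality_dep => k; apply: scalerDl. Qed.

HB.instance Definition _ := GRing.Zmodule_isLmodule.Build R[i] V
  dsum_scaleA dsum_scale1 dsum_scaleDr dsum_scaleDl.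

Definition dsum_ip x y : R[i] := \sum_k hip (x k) (y k).

Lemma dsum_ip_linl (a : R[i]) x y z :
  dsum_ip (a *: x + y) z = a * dsum_ip x z + dsum_ip y z.
Proof.
by rewrite mulr_sumr -big_split /=; apply: eq_bigr => k _; apply: hip_linl.
Qed.

Lemma dsum_ip_conj x y : dsum_ip y x = conjc (dsum_ip x y).
Proof. by rewrite rmorph_sum; apply: eq_bigr => k _; apply: hip_conj. Qed.

Lemma dsum_ip_ge0 x : 0 <= dsum_ip x x.
Proof. by apply: sumr_ge0 => k _; apply: hip_ge0. Qed.

Lemma dsum_ip_eq0 x : dsum_ip x x = 0 -> x = 0.
Proof.
move=> /eqP; rewrite psumr_eq0 => [/allP h|k _]; last exact: hip_ge0.
apply: functional_extensionality_dep => k; apply: hip_eq0; apply/eqP.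
by apply: h; rewrite mem_index_enum.
Qed.

Lemma Re_dsum_ip x : @complex.Re R (dsum_ip x x) = \sum_k hnorm (x k) ^+ 2.
Proof.
transitivity (@complex.Re R (\sum_k hnorm (x k) ^+ 2)%:C%C) => //; congr complex.Re.
by rewrite rmorph_sum; apply: eq_bigr => k _; rewrite /= hnorm_sqr -hip_rip.
Qed.

Lemma dsum_complete (u : nat -> V) :
    (forall e : R, 0 < e -> exists N : nat, forall m k : nat, (N <= m)%N -> (N <= k)%N ->
      Num.sqrt (@complex.Re R (dsum_ip (u m - u k) (u m - u k))) < e) ->
  exists v : V, forall e : R, 0 < e -> exists N : nat, forall m : nat, (N <= m)%N ->
    Num.sqrt (@complex.Re R (dsum_ip (u m - v) (u m - v))) < e.
Proof.
move=> cu.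
have cuk (k : 'I_n) : hcauchy (fun m => u m k).
  move=> e /cu[N hN]; exists N => m l Nm Nl; apply: le_lt_trans (hN m l Nm Nl).
  rewrite Re_dsum_ip -[leLHS]ger0_norm ?hnorm_ge0 // -sqrtr_sqr ler_wsqrtr //.
  by rewrite (bigD1 k) //= lerDl sumr_ge0 // => i _; rewrite sqr_ge0.
have [v hv] : exists v : V, forall k, hconv (fun m => u m k) (v k).
  exists (fun k => projT1 (cid (hcauchy_conv (cuk k)))) => k.
  exact: projT2 (cid (hcauchy_conv (cuk k))).
(* Componentwise error [e / sqrt (n + 1)]: the [n] squares then add up to at most [n e^2 / (n + 1)],
   strictly below [e^2], and [n = 0] needs no separate case. *)
exists v => e e0; pose e' := Num.sqrt (e ^+ 2 / n.+1%:R).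
have q0 : 0 < e ^+ 2 / n.+1%:R by rewrite divr_gt0 ?exprn_gt0 ?ltr0Sn.
have e'0 : 0 < e' by rewrite sqrtr_gt0.
have [N hN] := uniform_rank (fun k => hv k e' e'0); exists N => m Nm.
rewrite Re_dsum_ip -[ltRHS]ger0_norm ?(ltW e0) // -sqrtr_sqr ltr_sqrt ?exprn_gt0 //.
have : \sum_k hnorm ((u m - v) k) ^+ 2 <= \sum_(k < n) (e ^+ 2 / n.+1%:R).
  apply: ler_sum => k _; rewrite -[leRHS]sqr_sqrtr ?(ltW q0) // -/e'.
  by rewrite ler_sqr ?nnegrE ?hnorm_ge0 ?(ltW e'0) // ltW // hN.
move=> /le_lt_trans; apply; rewrite sumr_const card_ord -[_ *+ n]mulr_natr -mulrA.
rewrite -[ltRHS]mulr1 ltr_pM2l ?exprn_gt0 // mulrC ltr_pdivrMr ?ltr0Sn // mul1r.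
by rewrite ltr_nat.
Qed.

Definition dsum_hilbert : hilbertSpace R :=
  HilbertSpace dsum_ip_linl dsum_ip_conj dsum_ip_ge0 dsum_ip_eq0 dsum_complete.

Implicit Type w : dsum_hilbert.

Lemma hnorm_dsum w : hnorm w ^+ 2 = \sum_k hnorm (w k) ^+ 2.
Proof. by rewrite hnorm_sqr /rip Re_dsum_ip. Qed.

Lemma hnorm_component_le w k : hnorm (w k) <= hnorm w.
Proof.
rewrite -ler_sqr ?nnegrE ?hnorm_ge0 // hnorm_dsum (bigD1 k) //= lerDl.
by apply: sumr_ge0 => i _; rewrite sqr_ge0.
Qed.

Lemma hconv_component (u : nat -> dsum_hilbert) w k :
  hconv u w -> hconv (fun m => u m k) (w k).
Proof.
move=> cu e /cu[N hN]; exists N => m /hN; apply: le_lt_trans.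
exact: (hnorm_component_le (u m - w)).
Qed.

Lemma dsum_sumE (I : finType) (F : I -> dsum_hilbert) k :
  (\sum_i F i) k = \sum_i F i k.
Proof. exact: (big_morph (fun w : dsum_hilbert => w k)). Qed.

End DirectSum.
Arguments dsum_hilbert {R n} Hk.

(** * Coercivity of positive definite matrices *)

Section PositiveDefinite.
Context {R : realType} {n : nat} (M : 'M[R]_n).

(** [M] is invertible, so the [i]-th coordinate is represented in the form [b] by [w i], the [i]-th
    row of the inverse of [M]. Cauchy-Schwarz for [b] bounds [v_i^2] by [b (w i) (w i) * b v v];
    summing over [i] gives the constant, with no recourse to eigenvalues. *)
Lemma posdef_coercive : posdef M ->
  exists2 c : R, 0 < c & forall v : 'rV[R]_n,
    c * \sum_i v 0 i ^+ 2 <= (v *m M *m v^T) 0 0.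
Proof.
move=> [symM posM]; pose b (v w : 'rV[R]_n) : R := (v *m M *m w^T) 0 0.
have bC v w : b v w = b w v.
  rewrite /b -[v *m M *m w^T]trmxK mxE.
  by rewrite !trmx_mul trmxK symM mulmxA.
have b_ge0 v : 0 <= b v v.
  by have [->|v0] := eqVneq v 0; [rewrite /b !mul0mx mxE|apply/ltW/posM].
have unitM : M \in unitmx.
  rewrite -row_free_unit; apply: inj_row_free => v vM; apply/eqP.
  by apply: contraT => /posM; rewrite vM mul0mx mxE ltxx.
pose w i : 'rV[R]_n := delta_mx 0 i *m invmx M.
have bw (v : 'rV[R]_n) i : b (w i) v = v 0 i.
  rewrite /b /w mulmxKV // -rowE mxE.
  by rewrite mxE.
have cs (v : 'rV[R]_n) i : v 0 i ^+ 2 <= b (w i) (w i) * b v v.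
  have wi0 : w i != 0.
    apply/eqP => w0; have := bw (delta_mx 0 i) i.
    by rewrite w0 /b !mul0mx !mxE !eqxx => /eqP; rewrite eq_sym oner_eq0.
  have k0 : 0 < b (w i) (w i) by apply: posM.
  (* Cauchy-Schwarz for [M], through the discriminant in the direction [w i] *)
  have := b_ge0 (b (w i) (w i) *: v - v 0 i *: w i).
  have -> : b (b (w i) (w i) *: v - v 0 i *: w i) (b (w i) (w i) *: v - v 0 i *: w i)
    = b (w i) (w i) * (b (w i) (w i) * b v v - v 0 i ^+ 2).
    have bDl x y z : b (x + y) z = b x z + b y z by rewrite /b !mulmxDl mxE.
    have bZl a x z : b (a *: x) z = a * b x z by rewrite /b -!scalemxAl mxE.
    have bDr x y z : b z (x + y) = b z x + b z y by rewrite bC bDl !(bC z).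
    have bZr a x z : b z (a *: x) = a * b z x by rewrite bC bZl (bC z).
    rewrite -scaleNr !(bDl, bDr, bZl, bZr) (bC v (w i)) (bw v); ring.
  by rewrite pmulr_rge0 // subr_ge0.
pose k := \sum_i b (w i) (w i).
have k0 : 0 <= k by apply: sumr_ge0.
(* The added 1 keeps the constant positive and finite also for [n = 0], where [k = 0]. *)
exists (k + 1)^-1; first by rewrite invr_gt0; lra.
move=> v; rewrite mulrC ler_pdivrMr; last lra.
apply: le_trans (ler_sum _ (fun i _ => cs v i)) _.
by rewrite -mulr_suml mulrC ler_wpM2l // ?b_ge0 // -/k lerDl.
Qed.

End PositiveDefinite.

(** * Common subsequences and vanishing double sequences *)

Lemma increasing_comp (phi psi : nat -> nat) :
    (forall m, (phi m < phi m.+1)%N) -> (forall m, (psi m < psi m.+1)%N) ->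
  forall m, ((phi \o psi) m < (phi \o psi) m.+1)%N.
Proof. by move=> hphi hpsi m; apply: (homo_ltn ltn_trans hphi). Qed.

(** The indices are treated one after the other, each refining the current subsequence once;
    heredity of [P] preserves what was obtained for the earlier indices. *)
Lemma common_subsequence (I : finType) (P : I -> (nat -> nat) -> Prop) :
    (forall i phi psi, (forall m, (psi m < psi m.+1)%N) -> P i phi -> P i (phi \o psi)) ->
    (forall i phi, (forall m, (phi m < phi m.+1)%N) ->
      exists2 psi, (forall m, (psi m < psi m.+1)%N) & P i (phi \o psi)) ->
  exists2 phi, (forall m, (phi m < phi m.+1)%N) & forall i, P i phi.
Proof.
move=> her ref.
suff [phi inc hP] : exists2 phi, (forall m, (phi m < phi m.+1)%N) &
    forall i, i \in enum I -> P i phi.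
  by exists phi => // i; apply: hP; rewrite mem_enum.
elim: (enum I) => [|i s [phi inc hP]]; first by exists id.
have [psi incp Pi] := ref i phi inc.
exists (phi \o psi); first exact: increasing_comp.
by move=> j; rewrite inE => /orP[/eqP->//|/hP]; apply: her.
Qed.

Section Vanishing.
Context {R : realType}.
Implicit Types a b : nat -> nat -> R.

(** Two indices, because the quantities to control are norms of differences of two terms: a sequence
    is Cauchy when these vanish. *)
Definition vanishing a : Prop :=
  forall e : R, 0 < e -> exists N : nat, forall m k, (N <= m)%N -> (N <= k)%N -> a m k < e.

Lemma vanishingD a b : vanishing a -> vanishing b -> vanishing (fun m k => a m k + b m k).
Proof.
move=> va vb e e0.
have [|N hN] := va (e / 2); first lra.
have [|M hM] := vb (e / 2); first lra.
exists (maxn N M) => m k; rewrite !geq_max => /andP[Nm Mm] /andP[Nk Mk].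
by have := hN m k Nm Nk; have := hM m k Mm Mk; lra.
Qed.

Lemma vanishing_sum (I : Type) (s : seq I) (a : I -> nat -> nat -> R) :
  (forall i, vanishing (a i)) -> vanishing (fun m k => \sum_(i <- s) a i m k).
Proof.
move=> va; elim: s => [|i s IH] e e0.
  by exists 0%N => m k _ _; rewrite big_nil.
have [N hN] := vanishingD (va i) IH e0.
by exists N => m k Nm Nk; rewrite big_cons; apply: hN.
Qed.

Lemma vanishingZ (c : R) a : 0 <= c -> vanishing a -> vanishing (fun m k => c * a m k).
Proof.
move=> c0 va e e0; have c1 : 0 < c + 1 by lra.
have [|N hN] := va (e / (c + 1)); first exact: divr_gt0.
exists N => m k Nm Nk; have := hN m k Nm Nk; rewrite ltr_pdivlMr // => h.
by have [a0|a0] := lerP (a m k) 0; nra.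
Qed.

Lemma vanishing_sqr a :
  (forall m k, 0 <= a m k) -> vanishing a -> vanishing (fun m k => a m k ^+ 2).
Proof.
move=> a0 va e e0; have [|N hN] := va (Num.sqrt e); first by rewrite sqrtr_gt0.
exists N => m k Nm Nk; rewrite -[ltRHS]sqr_sqrtr ?(ltW e0) //.
by rewrite ltr_sqr ?nnegrE ?sqrtr_ge0 ?hN.
Qed.

End Vanishing.

(** * Lower bounds modulo compact operators *)

Section CompactCorrections.
Context {R : realType}.

(** Linearity is relative to [D] because [gamma_e] constrains its compact operators only on the
    orthogonal complement of the kernel. *)
Definition linear_on {H1 H2 : hilbertSpace R} (D : set H1) (K : H1 -> H2) : Prop :=
  forall (a : R[i]) x y, D x -> D y -> K (a *: x + y) = a *: K x + K y.

Lemma linear_onB {H1 H2 : hilbertSpace R} (D : set H1) (K : H1 -> H2) x y :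
  linear_on D K -> D x -> D y -> K (x - y) = K x - K y.
Proof. by move=> linK Dx Dy; rewrite addrC -scaleN1r linK // scaleN1r addrC. Qed.

Lemma kerA_perp_subspace {H1 H2 : hilbertSpace R} (A : H1 -> H2) :
  subspace (kerA_perp A).
Proof.
split=> [y _|a x y Sx Sy z Az]; first exact: hip0l.
by rewrite hipDl hipZl Sx // Sy // mulr0 addr0.
Qed.

Lemma kerA_perp_closed {H1 H2 : hilbertSpace R} (A : H1 -> H2) :
  hlinear A -> seq_closed (kerA_perp A).
Proof.
move=> linA u v Su uv y Ay; apply: hip0_rip; apply: (rip_conv0 uv) => m; rewrite /rip.
  by rewrite Su.
by rewrite Su // (hlinZ linA) Ay scaler0.
Qed.

(** The supremum need not be attained, hence the loss [d]. For an admissible [g'] with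
    [g' ^+ 2 >= g ^+ 2 - d], the operator inequality is paired with [x]: [As (A x)] contributes
    [|A x|^2] and [K x] at most [|x| |K x|]. *)
Lemma gamma_e_lower_bound {H1 H2 : hilbertSpace R} (A : H1 -> H2) (As : H2 -> H1) (g d : R) :
    is_adjoint A As -> 0 < g -> (g%:E <= gamma_e A As)%E -> 0 < d ->
  exists K : H1 -> H1, [/\ linear_on (kerA_perp A) K, compact_on (kerA_perp A) K &
    forall x, kerA_perp A x ->
      (g ^+ 2 - d) * hnorm x ^+ 2 <= hnorm (A x) ^+ 2 + hnorm x * hnorm (K x)].
Proof.
move=> adjA g0; rewrite /gamma_e; case: asboolP => [A0 _ d0|_ hg d0].
  (* For the zero operator [kerA_perp A] is reduced to 0, so the zero correction suffices. *)
  exists (fun=> 0); split.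
  - by move=> a x y _ _; rewrite scaler0 addr0.
  - move=> u _ _; exists id, 0; split=> // e e0; exists 0%N => m _.
    by rewrite subrr hnorm0.
  - move=> x Sx; have -> : x = 0 by apply: hip_eq0; apply: Sx.
    by rewrite A0 !hnorm0 expr0n /= mulr0 mul0r addr0.
(* [g ^+ 2 - d] may be negative, hence the maximum with 0; in either case [r < g], so some
   admissible [g'] exceeds [r]. *)
pose r := Num.sqrt (Num.max 0 (g ^+ 2 - d)).
have r2 : r ^+ 2 = Num.max 0 (g ^+ 2 - d) by rewrite sqr_sqrtr // le_max lexx.
have rg : r < g.
  rewrite -ltr_sqr ?nnegrE ?sqrtr_ge0 ?(ltW g0) // r2 gt_max exprn_gt0 //=; lra.
have rgE : (r%:E < g%:E)%E by rewrite lte_fin.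
have /ereal_sup_gt := lt_le_trans rgE hg.
move=> [_ [g' [g'0 [K [_ [linK [cK [_ hK]]]]]] <-]]; rewrite lte_fin => rg'.
exists K; split=> // x Sx.
have gg : g ^+ 2 - d <= g' ^+ 2.
  have : r ^+ 2 <= g' ^+ 2 by rewrite ler_sqr ?nnegrE ?sqrtr_ge0 // ltW.
  by rewrite r2 ge_max => /andP[].
have := hK x Sx; rewrite lecE => /andP[_].
rewrite -/(rip (As (A x) + K x) x) ripDl [rip (As _) x]ripC /rip -adjA.
rewrite hip_rip -rmorphM /= -/(rip (A x) (A x)) -/(rip (K x) x) -!hnorm_sqr => h.
have := rip_le (K x) x; have := sqr_ge0 (hnorm x); nra.
Qed.

Lemma opnorm_bound {H1 H2 : hilbertSpace R} (T : H1 -> H2) (c : R) :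
  hlinear T -> (opnorm T <= c%:E)%E -> forall x, hnorm (T x) <= c * hnorm x.
Proof.
move=> linT hT x; have [x0|x0] := eqVneq (hnorm x) 0.
  by rewrite (hnorm0_eq0 x0) (hlin0 linT) !hnorm0 mulr0.
have px : 0 < hnorm x by rewrite lt_def x0 hnorm_ge0.
have : ((hnorm (T ((hnorm x)^-1%:C%C *: x)))%:E <= c%:E)%E.
  apply: le_trans hT; apply: ereal_sup_ubound.
  exists ((hnorm x)^-1%:C%C *: x) => //=.
  by rewrite hnormZ ger0_norm ?invr_ge0 ?hnorm_ge0 // mulVf.
rewrite lee_fin (hlinZ linT) hnormZ ger0_norm ?invr_ge0 ?hnorm_ge0 //.
by rewrite mulrC ler_pdivrMr.
Qed.

(** Choose a compact [K] for which [As B + K] has norm at most [c + d], and split [rip (A x) (B y)]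
    as [rip x (As (B y) + K y) - rip x (K y)]; Cauchy-Schwarz bounds both terms. *)
Lemma essnorm_lower_bound {H1 H2 H : hilbertSpace R}
    (A : H1 -> H) (As : H -> H1) (B : H2 -> H) (c d : R) :
    is_adjoint A As -> hlinear B ->
    (essnorm (fun x : H2 => As (B x)) <= c%:E)%E -> 0 < d ->
  exists K : H2 -> H1, [/\ hlinear K, compact_on setT K &
    forall x y, (- c - d) * (hnorm x * hnorm y) <=
      rip (A x) (B y) + hnorm x * hnorm (K y)].
Proof.
move=> adjA linB hc d0; have linAs := adjoint_linear adjA.
have /ereal_inf_lt : (essnorm (fun x : H2 => As (B x)) < (c + d)%:E)%E.
  by apply: le_lt_trans hc _; rewrite lte_fin; lra.
move=> [_ [K [[linK bK] cK] <-] /ltW hK]; exists K; split=> // x y.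
have linT : hlinear (fun x => As (B x) + K x).
  by move=> a v w; rewrite linB linAs linK scalerDr addrACA.
have := opnorm_bound linT hK y.
have -> : rip (A x) (B y) = rip x (As (B y) + K y) - rip x (K y).
  by rewrite ripDr addrK /rip adjA.
have := norm_rip_le x (As (B y) + K y); rewrite ler_norml => /andP[h1 _].
have := rip_le x (K y); have := hnorm_ge0 x; nra.
Qed.

End CompactCorrections.

(** * The sum map of the family and the two conclusions *)

Section Family.
Context {R : realType} {n : nat} {Hk : 'I_n -> hilbertSpace R} {H : hilbertSpace R}.
Variables (A : forall k : 'I_n, Hk k -> H) (As : forall k : 'I_n, H -> Hk k).
Variables (gam : 'I_n -> R) (eps : 'I_n -> 'I_n -> R).
Hypotheses (bA : forall k, bounded_op (@A k))
  (adjA : forall k, is_adjoint (@A k) (@As k))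
  (hgam : forall k, 0 < gam k /\ ((gam k)%:E <= gamma_e (@A k) (@As k))%E)
  (heps : forall i j, i != j ->
     (essnorm (fun x : Hk j => @As i (@A j x)) <= (eps i j)%:E)%E).

Let M : 'M[R]_n := \matrix_(i < n, j < n) (if i == j then gam i ^+ 2 else - eps i j).
Hypothesis posM : posdef M.

Local Notation G := (dsum_hilbert Hk).

Definition sum_map (x : G) : H := \sum_k A (x k).

Definition perp_family : set G := [set x | forall k, kerA_perp (@A k) (x k)].

Lemma sum_map_bounded : bounded_op sum_map.
Proof.
split=> [a x y|].
  by rewrite /sum_map scaler_sumr -big_split /=; apply: eq_bigr => k _; rewrite (bA k).1.
have /choice[C hC] k := (bA k).2; exists (\sum_k `|C k|) => x.
rewrite mulr_suml /sum_map; elim/big_rec2: _ => [|k c v _ h]; first by rewrite hnorm0.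
apply: le_trans (hnormD _ _) (lerD _ h); apply: le_trans (hC k _) _.
apply: le_trans (ler_wpM2r (hnorm_ge0 _) (ler_norm _)) _.
by rewrite ler_wpM2l // hnorm_component_le.
Qed.

Lemma perp_family_subspace : subspace perp_family.
Proof.
split=> [k|a x y Sx Sy k]; first exact: (kerA_perp_subspace _).1.
exact: (kerA_perp_subspace _).2.
Qed.

Lemma perp_family_closed : seq_closed perp_family.
Proof.
move=> u v Su uv k; apply: (kerA_perp_closed (bA k).1) (hconv_component k uv) => m.
exact: Su.
Qed.

(** One shape for all entries of [M]: the diagonal comes from [gamma_e], the rest from the essential
    norms. *)
Lemma pair_lower_bound (d : R) i j : 0 < d ->
  exists K : Hk j -> Hk i, [/\ linear_on (kerA_perp (@A j)) K,
    compact_on (kerA_perp (@A j)) K &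
    forall x : G, perp_family x ->
      (M i j - d) * (hnorm (x i) * hnorm (x j)) <=
      rip (A (x i)) (A (x j)) + hnorm (x i) * hnorm (K (x j))].
Proof.
move=> d0; rewrite mxE; have [<-|ij] := eqVneq i j.
  have [g0 hg] := hgam i; have [K [linK cK hK]] := gamma_e_lower_bound (@adjA i) g0 hg d0.
  exists K; split=> // x Sx; rewrite -expr2 -hnorm_sqr.
  exact: hK.
have [K [linK cK hK]] := essnorm_lower_bound (@adjA i) (bA j).1 (heps ij) d0.
exists K; split=> [a x y _ _|u _|x _]; [exact: linK|exact: cK|exact: hK].
Qed.

(** Expanding [|sum_map x|^2] into pairs and adding the pair bounds produces the form of [M] at the
    vector of component norms, minus [d (\sum_k |x_k|)^2]. Coercivity bounds the form below by
    [c |x|^2]. *)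
Lemma sum_map_lower_bound :
  exists2 c : R, 0 < c & exists K : forall i j : 'I_n, Hk j -> Hk i,
    [/\ forall i j, linear_on (kerA_perp (@A j)) (K i j),
        forall i j, compact_on (kerA_perp (@A j)) (K i j) &
        forall x : G, perp_family x ->
          c * hnorm x ^+ 2 <=
          hnorm (sum_map x) ^+ 2 + hnorm x * \sum_i \sum_j hnorm (K i j (x j))].
Proof.
have [c c0 hc] := posdef_coercive posM.
(* Since [\sum_k |x_k| <= (n + 1) |x|], this choice makes the total loss at most half of the
   coercivity term. *)
pose d := c / (2 * n.+1%:R ^+ 2).
have n0 : 0 < n.+1%:R :> R by rewrite ltr0Sn.
have d0 : 0 < d by rewrite divr_gt0 // mulr_gt0 // exprn_gt0.
pose K i j := projT1 (cid (@pair_lower_bound d i j d0)).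
have hK i j := projT2 (cid (@pair_lower_bound d i j d0)).
exists (c / 2); first lra.
exists K; split=> [i j|i j|x Sx]; try by case: (hK i j).
pose t : 'rV[R]_n := \row_k hnorm (x k).
have q : \sum_k t 0 k ^+ 2 = hnorm x ^+ 2.
  by rewrite hnorm_dsum; apply: eq_bigr => k _; rewrite mxE.
have := hc t; rewrite q => hct.
have form : (t *m M *m t^T) 0 0 = \sum_i \sum_j M i j * (hnorm (x i) * hnorm (x j)).
  rewrite mxE exchange_big; apply: eq_bigr => j _; rewrite mxE mulr_suml.
  by apply: eq_bigr => i _; rewrite !mxE; ring.
have sum_le : \sum_k hnorm (x k) <= n.+1%:R * hnorm x.
  apply: le_trans (ler_sum _ (fun k _ => hnorm_component_le x k)) _.
  by rewrite sumr_const card_ord -[_ *+ n]mulr_natl ler_wpM2r ?hnorm_ge0 // ler_nat.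
have sum_ge0 : 0 <= \sum_k hnorm (x k) by apply: sumr_ge0 => k _; apply: hnorm_ge0.
have dsq : d * (\sum_k hnorm (x k)) ^+ 2 <= c / 2 * hnorm x ^+ 2.
  have -> : c / 2 * hnorm x ^+ 2 = d * (n.+1%:R * hnorm x) ^+ 2.
    by rewrite /d; field; rewrite gt_eqF.
  by rewrite ler_pM2l // ler_sqr ?nnegrE ?mulr_ge0 ?hnorm_ge0.
have norm2 : hnorm (sum_map x) ^+ 2 = \sum_i \sum_j rip (A (x i)) (A (x j)).
  by rewrite hnorm_sqr rip_suml; apply: eq_bigr => i _; rewrite rip_sumr.
have : \sum_i \sum_j (M i j - d) * (hnorm (x i) * hnorm (x j)) <=
    \sum_i \sum_j (rip (A (x i)) (A (x j)) + hnorm x * hnorm (K i j (x j))).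
  apply: ler_sum => i _; apply: ler_sum => j _; case: (hK i j) => _ _ /(_ x Sx) h.
  apply: le_trans h _; rewrite lerD2l ler_wpM2r ?hnorm_ge0 //.
  exact: hnorm_component_le.
have -> : \sum_i \sum_j (M i j - d) * (hnorm (x i) * hnorm (x j)) =
    (t *m M *m t^T) 0 0 - d * (\sum_k hnorm (x k)) ^+ 2.
  rewrite form expr2 mulr_suml mulr_sumr -sumrB; apply: eq_bigr => i _.
  by rewrite !mulr_sumr -sumrB; apply: eq_bigr => j _; rewrite mulrBl.
have -> : \sum_i \sum_j (rip (A (x i)) (A (x j)) + hnorm x * hnorm (K i j (x j))) =
    hnorm (sum_map x) ^+ 2 + hnorm x * \sum_i \sum_j hnorm (K i j (x j)).
  rewrite norm2 mulr_sumr -big_split; apply: eq_bigr => i _.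
  by rewrite mulr_sumr -big_split.
lra.
Qed.

(** Along a common subsequence all the [K i j (u m j)] are Cauchy. The lower bound, applied to
    differences of terms, then controls them by quantities that vanish. *)
Lemma sum_map_proper : proper_on perp_family sum_map.
Proof.
have [c c0 [K [linK cK hK]]] := sum_map_lower_bound.
move=> u Su [C bu] cTu.
pose P (ij : 'I_n * 'I_n) (phi : nat -> nat) :=
  hcauchy (fun m => K ij.1 ij.2 (u (phi m) ij.2)).
have [|[i j] phi inc|phi inc hP] := @common_subsequence _ P.
- by move=> [i j] phi psi inc cphi; apply: hcauchy_sub cphi.
- have [||psi [y [incpsi cy]]] := cK i j (fun m => u (phi m) j).
  + by move=> m; apply: Su.
  + by exists C => m; apply: le_trans (bu (phi m)); apply: hnorm_component_le.
  by exists psi => //; apply: hconv_cauchy cy.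
exists phi; split=> // e e0.
have C0 : 0 <= C by apply: le_trans (bu 0%N); apply: hnorm_ge0.
pose a m k := hnorm (sum_map (u (phi m)) - sum_map (u (phi k))).
pose b i j m k := hnorm (K i j (u (phi m) j) - K i j (u (phi k) j)).
(* The factor [2 * C] bounds the norm of a difference of two terms of [u]. *)
have va : vanishing (fun m k => a m k ^+ 2 + 2 * C * \sum_i \sum_j b i j m k).
  apply: vanishingD.
    apply: vanishing_sqr => [m k|]; first exact: hnorm_ge0.
    exact: (hcauchy_sub inc cTu).
  apply: vanishingZ; first lra.
  apply: vanishing_sum => i; apply: vanishing_sum => j; exact: (hP (i, j)).
have [N hN] := va (c * e ^+ 2) (mulr_gt0 c0 (exprn_gt0 2 e0)).
exists N => m k Nm Nk /=; rewrite -ltr_sqr ?nnegrE ?hnorm_ge0 ?(ltW e0) //.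
rewrite -(ltr_pM2l c0); apply: le_lt_trans (hN m k Nm Nk).
have Sd : perp_family (u (phi m) - u (phi k)).
  exact: (subspaceB perp_family_subspace (Su _) (Su _)).
apply: le_trans (hK _ Sd) _; rewrite (hlinB sum_map_bounded.1) lerD2l.
have -> : \sum_i \sum_j hnorm (K i j ((u (phi m) - u (phi k)) j)) = \sum_i \sum_j b i j m k.
  apply: eq_bigr => i _; apply: eq_bigr => j _; congr hnorm.
  by apply: (linear_onB (linK i j)); apply: Su.
apply: ler_wpM2r.
  by apply: sumr_ge0 => i _; apply: sumr_ge0 => j _; apply: hnorm_ge0.
by have := hnorm_triB (u (phi m)) (u (phi k)); have := bu (phi m); have := bu (phi k); lra.
Qed.

(** Removing from each component its part in the kernel of [A k] changes no image, so sums over the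
    full spaces are already reached from [perp_family]. This is [orthogonal_lift] with the whole
    space as [S]. *)
Lemma perp_lift (x : G) : exists2 p : G, perp_family p & forall k, A (p k) = A (x k).
Proof.
have ex k : exists p : Hk k, kerA_perp (@A k) p /\ A p = A (x k).
  have [||p [_ Ap pp]] := @orthogonal_lift _ _ _ setT (@A k) (x k) _ _ (bA k) I.
  - by [].
  - by [].
  by exists p; split=> // y Ay; apply: pp.
exists (fun k => projT1 (cid (ex k))) => k; by case: (projT2 (cid (ex k))).
Qed.

(** A vector [v = A_i z] that is also a sum of the other [w j] gives a relation, which lifts to some
    [p] in the kernel of [sum_map] on [perp_family] with [v = - A (p i)]. The intersection thus lies
    in the image of a finite-dimensional kernel, spanned by the [- A (y i)] for [y] in a spanning
    list. *)
Lemma family_ess_lin_indep : ess_lin_indep (fun k => range (@A k)).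
Proof.
move=> i.
have [s hs] := proper_kernel_finite_dim perp_family_subspace sum_map_bounded sum_map_proper.
exists [seq - A (y i) | y : G <- s] => v [[z _ zv] [w [Rw vE]]].
have ex j : exists x : Hk j, A x = w j by have [x _ <-] := Rw j; exists x.
(* the relation [A_i z = \sum_(j != i) A_j x_j] as an element of the kernel *)
pose x : G := dfwith (fun j => projT1 (cid (ex j))) (- z).
have xi : x i = - z by rewrite /x dfwith_in.
have xj j : j != i -> A (x j) = w j.
  by move=> ji; rewrite /x dfwith_out 1?eq_sym //; apply: projT2 (cid (ex j)).
have [p Sp Ap] := perp_lift x.
have Tp : sum_map p = 0.
  rewrite /sum_map (bigD1 i) //= Ap xi (hlinN (bA i).1) zv vE addrC.
  by apply/eqP; rewrite subr_eq0; apply/eqP/eq_bigr => j ji; rewrite Ap xj.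
have [c pE] := hs p (conj Sp Tp); exists c; rewrite size_map.
have -> : v = - A (p i) by rewrite Ap xi (hlinN (bA i).1) opprK.
rewrite pE dsum_sumE (hlin_sum (bA i).1) -sumrN; apply: eq_bigr => k _.
rewrite (nth_map 0) // scalerN; congr (- _); exact: (hlinZ (bA i).1).
Qed.

(** By [perp_lift] the full sum of ranges is the image of [perp_family] under [sum_map], to which
    [proper_range_closed] applies. *)
Lemma family_range_closed :
  hclosed [set v : H | exists x : forall k : 'I_n, Hk k, v = \sum_(k < n) A (x k)].
Proof.
move=> v hv.
have [|x _ <-] := proper_range_closed perp_family_subspace perp_family_closed
  sum_map_bounded sum_map_proper (v := v); last by exists x.
move=> e /hv[_ [x ->] h]; exists (\sum_k A (x k)) => //.
have [p Sp Ap] := perp_lift x; exists p => //.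
by apply: eq_bigr => k _; rewrite Ap.
Qed.

End Family.
Unset Implicit Arguments.

Theorem mainTheorem1 (R : realType) (n : nat) (hn : (1 <= n)%N)
  (Hk : 'I_n -> hilbertSpace R) (H : hilbertSpace R)
  (A : forall k : 'I_n, Hk k -> H) (As : forall k : 'I_n, H -> Hk k)
  (gam : 'I_n -> R) (eps : 'I_n -> 'I_n -> R) :
  (forall k, bounded_op (A k)) ->
  (forall k, is_adjoint (A k) (As k)) ->
  (forall k, hclosed (range (A k))) ->
  (forall i j, i != j -> eps i j = eps j i) ->
  (forall k, 0 < gam k /\ ((gam k)%:E <= gamma_e (A k) (As k))%E) ->
  (forall i j, i != j -> (essnorm (fun x : Hk j => As i (A j x)) <= (eps i j)%:E)%E) ->
  posdef (\matrix_(i < n, j < n) (if i == j then gam i ^+ 2 else - eps i j)) ->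
  ess_lin_indep (fun k => range (A k)) /\
  hclosed [set v : H | exists x : forall k : 'I_n, Hk k, v = \sum_(k < n) A k (x k)].
Proof.
move=> bA adjA _ _ hgam heps posM; split.
- exact: family_ess_lin_indep bA adjA hgam heps posM.
- exact: family_range_closed bA adjA hgam heps posM.
Qed.
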